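(* Let $R$ be a commutative noetherian ring, $C$ a semidualizing $R$-module, and $x,y\in R$. If $x,y$ form a pair of exact zero-divisors on both $R$ and $C$, then $R/xR\in\mathcal A_C(R)$.
   Context: Rings are commutative noetherian with identity; ''finite'' means finitely generated. A finite $R$-module $C$ is semidualizing if the natural homothety map $R\to\operatorname{Hom}_R(C,C)$ is an isomorphism and $\operatorname{Ext}^i_R(C,C)=0$ for all $i>0$. For an $R$-module $M$ and $x,y\in R$, one says that $x,y$ form a pair of exact zero-divisors on $M$ if $xM\neq 0$, $xM\neq M$ and the sequence of multiplication maps $M\xrightarrow{x}M\xrightarrow{y}M\xrightarrow{x}M$ is exact. The Auslander class $\mathcal A_C(R)$ is the class of all $R$-modules $M$ (not necessarily finite) such that (1) the natural map $M\to\operatorname{Hom}_R(C,C\otimes_RM)$, $m\mapsto(c\mapsto c\otimes m)$, is an isomorphism; (2) $\operatorname{Tor}^R_i(C,M)=0=\operatorname{Ext}^i_R(C,C\otimes_RM)$ for all $i>0$. *)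

(* Defs.v *)
From HB Require Import structures.
From mathcomp Require Import all_boot all_algebra ring_quotient.
From mathcomp Require Import boolp classical_sets.
From mathcomp Require Import freeg.

Set Implicit Arguments.
Unset Strict Implicit.
Unset Printing Implicit Defensive.

Import GRing.Theory.
Local Open Scope ring_scope.
Local Open Scope classical_set_scope.
Local Open Scope quotient_scope.

Section Submodules.
Variables (R : comNzRingType) (M N : lmodType R).

Definition ker_pred (f : {linear M -> N}) : {pred M} := [pred x | f x == 0].

Definition im_pred (f : {linear M -> N}) : {pred N} :=
  [pred y | `[< exists x, y = f x >]].

Definition span_pred (A : set M) : {pred M} :=
  [pred m | `[< forall S : submodClosed M, (forall a, A a -> a \in S) ->
                m \in S >]].

Lemma ker_submod f : submod_closed (ker_pred f).
Proof.
split=> [|a u v]; rewrite !inE ?linear0 // => /eqP fu /eqP fv.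
by rewrite linearP fu fv scaler0 addr0.
Qed.

Lemma im_submod f : submod_closed (im_pred f).
Proof.
split=> [|a _ _ /asboolP[u ->] /asboolP[v ->]]; apply/asboolP.
  by exists 0; rewrite linear0.
by exists (a *: u + v); rewrite linearP.
Qed.

Lemma span_submod A : submod_closed (span_pred A).
Proof.
split=> [|a u v /asboolP Su /asboolP Sv]; apply/asboolP => S AS.
  exact: rpred0.
by rewrite rpredD ?rpredZ ?Su ?Sv.
Qed.

HB.instance Definition _ f :=
  GRing.isSubmodClosed.Build R M (ker_pred f) (ker_submod f).
HB.instance Definition _ f :=
  GRing.isSubmodClosed.Build R N (im_pred f) (im_submod f).
HB.instance Definition _ A :=
  GRing.isSubmodClosed.Build R M (span_pred A) (span_submod A).

End Submodules.

Section Kernel.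
Variables (R : comNzRingType) (M N : lmodType R) (f : {linear M -> N}).

Definition kernel : Type := {x : M | x \in ker_pred f}.

HB.instance Definition _ := [isSub of kernel for @sval _ _].
HB.instance Definition _ := [Choice of kernel by <:].
HB.instance Definition _ := [SubChoice_isSubLmodule of kernel by <:].

End Kernel.

Section Quotients.
Variables (R : comNzRingType) (M : lmodType R) (S : submodClosed M).

(* [submodClosed] does not inherit from [zmodClosed] in the library, although
   closure under [-1 *: _] makes every submodule an additive subgroup. *)
Definition subgroup_of : {pred M} := fun m => m \in S.

Lemma subgroup_of_closed : zmod_closed subgroup_of.
Proof. exact: (GRing.submod_closedB (submodClosedP S)). Qed.

HB.instance Definition _ :=
  GRing.isZmodClosed.Build M subgroup_of subgroup_of_closed.

Definition quotmod : Type := Quotient.quot subgroup_of.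

HB.instance Definition _ := GRing.Zmodule.on quotmod.

Definition qclass (m : M) : quotmod := \pi_(Quotient.quot subgroup_of) m.

Lemma qclassB : zmod_morphism qclass.
Proof. by move=> u v; rewrite /qclass raddfB. Qed.

Lemma qclass_eq u v : (qclass u = qclass v) <-> (u - v \in S).
Proof.
rewrite -[_ \in S]/(u - v \in subgroup_of) Quotient.idealrBE; split=> [E|/eqP //].
exact/eqP.
Qed.

Lemma qclassP (q : quotmod) : exists m, q = qclass m.
Proof. by exists (repr q); rewrite /qclass reprK. Qed.

Definition qscale (a : R) (q : quotmod) : quotmod := qclass (a *: repr q).

Lemma qscaleE a m : qscale a (qclass m) = qclass (a *: m).
Proof.
apply/qclass_eq; rewrite -scalerBr rpredZ //; apply/qclass_eq.
by rewrite /qclass reprK.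
Qed.

Fact qscaleA a b q : qscale a (qscale b q) = qscale (a * b) q.
Proof. by have [m ->] := qclassP q; rewrite !qscaleE scalerA. Qed.

Fact qscale1 : left_id 1 qscale.
Proof. by move=> q; have [m ->] := qclassP q; rewrite qscaleE scale1r. Qed.

Lemma qclassD u v : qclass (u + v) = qclass u + qclass v.
Proof. by rewrite /qclass raddfD. Qed.

Fact qscaleDr : right_distributive qscale +%R.
Proof.
move=> a p q; have [u ->] := qclassP p; have [v ->] := qclassP q.
by rewrite -qclassD !qscaleE scalerDr qclassD.
Qed.

Fact qscaleDl q : {morph qscale^~ q : a b / a + b}.
Proof.
by move=> a b; have [m ->] := qclassP q; rewrite !qscaleE scalerDl qclassD.
Qed.

HB.instance Definition _ := GRing.Zmodule_isLmodule.Build R quotmod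
  qscaleA qscale1 qscaleDr qscaleDl.

Fact qclass_is_linear : linear qclass.
Proof. by move=> a u v; rewrite qclassD -qscaleE. Qed.

HB.instance Definition _ := GRing.isLinear.Build R M quotmod *:%R qclass
  qclass_is_linear.

Section Lift.
Variables (N : lmodType R) (f : {linear M -> N}).
Hypothesis f0 : forall m, m \in S -> f m = 0.

Definition qlift (q : quotmod) : N := f (repr q).

Lemma qliftE m : qlift (qclass m) = f m.
Proof.
apply/eqP; rewrite -subr_eq0 -linearB f0 //; apply/qclass_eq.
by rewrite /qclass reprK.
Qed.

Fact qlift_is_linear : linear qlift.
Proof.
move=> a p q; have [u ->] := qclassP p; have [v ->] := qclassP q.
by rewrite -linearP !qliftE linearP.
Qed.

Definition qlift_linear : {linear quotmod -> N} :=
  HB.pack qlift (GRing.isLinear.Build R quotmod N *:%R qlift qlift_is_linear).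

End Lift.
End Quotients.

Section Hom.
Variables (R : comNzRingType) (M N : lmodType R).

Definition linHom : Type := {linear M -> N}.

HB.instance Definition _ := gen_eqMixin linHom.
HB.instance Definition _ := gen_choiceMixin linHom.

Lemma linHom_eq (f g : linHom) : f =1 g -> f = g.
Proof.
case: f => f [fA fZ]; case: g => g [gA gZ] /= /funext E.
case: _ / E in gA gZ *.
congr GRing.Linear.Pack; congr GRing.Linear.Class.
  case: fA => p; case: gA => q; congr Algebra.isNmodMorphism.Axioms_.
  exact: Prop_irrelevance.
case: fZ => p; case: gZ => q; congr GRing.isScalable.Axioms_.
exact: Prop_irrelevance.
Qed.

Definition hom_zero : linHom := [the {linear M -> N} of \0].
Definition hom_opp (f : linHom) : linHom := [the {linear M -> N} of \- f].
Definition hom_add (f g : linHom) : linHom := [the {linear M -> N} of f \+ g].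
Definition hom_scale (a : R) (f : linHom) : linHom :=
  [the {linear M -> N} of a \*: f].

Fact hom_addA : associative hom_add.
Proof. by move=> f g h; apply: linHom_eq => x /=; rewrite addrA. Qed.
Fact hom_addC : commutative hom_add.
Proof. by move=> f g; apply: linHom_eq => x /=; rewrite addrC. Qed.
Fact hom_add0 : left_id hom_zero hom_add.
Proof. by move=> f; apply: linHom_eq => x /=; rewrite add0r. Qed.
Fact hom_addN : left_inverse hom_zero hom_opp hom_add.
Proof. by move=> f; apply: linHom_eq => x /=; rewrite addNr. Qed.

HB.instance Definition _ :=
  GRing.isZmodule.Build linHom hom_addA hom_addC hom_add0 hom_addN.

Fact hom_scaleA a b f : hom_scale a (hom_scale b f) = hom_scale (a * b) f.
Proof. by apply: linHom_eq => x /=; rewrite scalerA. Qed.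
Fact hom_scale1 : left_id 1 hom_scale.
Proof. by move=> f; apply: linHom_eq => x /=; rewrite scale1r. Qed.
Fact hom_scaleDr : right_distributive hom_scale +%R.
Proof. by move=> a f g; apply: linHom_eq => x /=; rewrite scalerDr. Qed.
Fact hom_scaleDl f : {morph hom_scale^~ f : a b / a + b}.
Proof. by move=> a b; apply: linHom_eq => x /=; rewrite scalerDl. Qed.

HB.instance Definition _ := GRing.Zmodule_isLmodule.Build R linHom
  hom_scaleA hom_scale1 hom_scaleDr hom_scaleDl.

End Hom.

Section HomPrecomp.
Variables (R : comNzRingType) (M M' N : lmodType R) (f : {linear M -> M'}).

Definition hom_precomp (g : linHom M' N) : linHom M N :=
  [the {linear M -> N} of g \o f].

Fact hom_precomp_is_linear : linear hom_precomp.
Proof. by move=> a g h; apply: linHom_eq. Qed.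

HB.instance Definition _ := GRing.isLinear.Build R (linHom M' N) (linHom M N) *:%R
  hom_precomp hom_precomp_is_linear.

End HomPrecomp.

Arguments hom_precomp {R M M'} N f g.

Section FreeLift.
Variables (R : comNzRingType) (K : choiceType) (M : lmodType R) (f : K -> M).

Definition free_lift (D : {freeg K / R}) : M := fglift f D.

Fact free_lift_is_linear : linear free_lift.
Proof.
have fB : zmod_morphism free_lift by exact: lift_is_additive.
pose h : {additive {freeg K / R} -> M} :=
  HB.pack free_lift (GRing.isZmodMorphism.Build _ _ _ fB).
have hE D : free_lift D = h D by [].
have hZ a D : free_lift (a *: D) = a *: free_lift D.
  rewrite -[in RHS](freeg_sumE D) -[a *: D]/(fgscale a D) /fgscale !hE.
  rewrite !(raddf_sum h) scaler_sumr; apply: eq_bigr => i _.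
  by rewrite /= /free_lift !liftU scalerA.
by move=> a D E; rewrite -hZ hE raddfD.
Qed.

HB.instance Definition _ := GRing.isLinear.Build R {freeg K / R} M *:%R
  free_lift free_lift_is_linear.

End FreeLift.

Section Tensor.
Variables (R : comNzRingType) (A B : lmodType R).

Inductive tensor_rel : set {freeg (A * B)%type / R} :=
| tensor_relDl a a' b :
    tensor_rel (<< (a + a', b) >> - (<< (a, b) >> + << (a', b) >>))
| tensor_relDr a b b' :
    tensor_rel (<< (a, b + b') >> - (<< (a, b) >> + << (a, b') >>))
| tensor_relZl r a b :
    tensor_rel (<< (r *: a, b) >> - r *: << (a, b) >>)
| tensor_relZr r a b :
    tensor_rel (<< (a, r *: b) >> - r *: << (a, b) >>).

Definition tensor : lmodType R := quotmod (span_pred tensor_rel).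

Definition tens (a : A) (b : B) : tensor :=
  qclass (span_pred tensor_rel) << (a, b) >>.

Let cls := [the {linear {freeg (A * B)%type / R} -> tensor} of
  qclass (span_pred tensor_rel)].

Lemma tensor_rel_eq (D E : {freeg (A * B)%type / R}) :
  tensor_rel (D - E) -> cls D = cls E.
Proof. by move=> DE; apply/qclass_eq/asboolP => S; apply. Qed.

Lemma tensDl a a' b : tens (a + a') b = tens a b + tens a' b.
Proof.
exact: etrans (tensor_rel_eq (tensor_relDl a a' b)) (linearD cls _ _).
Qed.

Lemma tensDr a b b' : tens a (b + b') = tens a b + tens a b'.
Proof.
exact: etrans (tensor_rel_eq (tensor_relDr a b b')) (linearD cls _ _).
Qed.

Lemma tensZl r a b : tens (r *: a) b = r *: tens a b.
Proof.
exact: etrans (tensor_rel_eq (tensor_relZl r a b)) (linearZ_LR cls _ _).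
Qed.

Lemma tensZr r a b : tens a (r *: b) = r *: tens a b.
Proof.
exact: etrans (tensor_rel_eq (tensor_relZr r a b)) (linearZ_LR cls _ _).
Qed.

Fact tens_is_linearl b : linear (tens^~ b).
Proof. by move=> r a a'; rewrite tensDl tensZl. Qed.

Fact tens_is_linearr a : linear (tens a).
Proof. by move=> r b b'; rewrite tensDr tensZr. Qed.

Definition tensl b : {linear A -> tensor} :=
  HB.pack (tens^~ b) (GRing.isLinear.Build _ _ _ _ _ (tens_is_linearl b)).

Definition tensr a : {linear B -> tensor} :=
  HB.pack (tens a) (GRing.isLinear.Build _ _ _ _ _ (tens_is_linearr a)).

End Tensor.

Section TensorMap.
Variables (R : comNzRingType) (A A' B : lmodType R) (f : {linear A -> A'}).

Let pairing (p : A * B) : tensor A' B := tens (f p.1) p.2.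

Lemma tensor_map_subproof D :
  D \in span_pred (@tensor_rel R A B) -> free_lift pairing D = 0.
Proof.
move=> /asboolP/(_ (ker_pred (free_lift pairing))) H; apply/eqP/H => {H D} D.
have E p : free_lift pairing << p >> = pairing p.
  by rewrite /free_lift liftU scale1r.
pose L := [the {linear {freeg (A * B)%type / R} -> tensor A' B} of
  free_lift pairing].
by case=> [a a' b|a b b'|r a b|r a b]; rewrite inE (linearB L) subr_eq0
  ?(linearD L) ?(linearZ_LR L) /= !E /pairing /= ?(linearD f) ?(linearZ_LR f)
  (tensDl, tensDr, tensZl, tensZr).
Qed.

(* f (x) id_B *)
Definition tensor_map : {linear tensor A B -> tensor A' B} :=
  qlift_linear tensor_map_subproof.

Lemma tensor_mapE a b : tensor_map (tens a b) = tens (f a) b.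
Proof.
apply: (etrans (qliftE tensor_map_subproof _)).
by rewrite /= /free_lift liftU scale1r.
Qed.

End TensorMap.

Section Homology.
Variables (R : comNzRingType) (A B D : lmodType R).
Variables (f : {linear A -> B}) (g : {linear B -> D}).

Definition homology_incl : {linear kernel g -> B} := [the {linear _ -> _} of val].

Lemma homology_inclP (z : kernel g) : g (homology_incl z) = 0.
Proof. exact/eqP/(valP z). Qed.

Definition boundary_pred : {pred kernel g} :=
  [pred z | homology_incl z \in im_pred f].

Lemma boundary_submod : submod_closed boundary_pred.
Proof.
split=> [|a u v fu fv]; rewrite unfold_in.
  by rewrite (linear0 homology_incl) rpred0.
by rewrite (linearP homology_incl) rpredD ?rpredZ.
Qed.

HB.instance Definition _ :=
  GRing.isSubmodClosed.Build R (kernel g) boundary_pred boundary_submod.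

(* ker g / im f, meaningful when g \o f = 0; in general it is
   ker g / (ker g :&: im f). *)
Definition homology : lmodType R := quotmod boundary_pred.

End Homology.

Definition zero_linear (R : comNzRingType) (A B : lmodType R) :
  {linear A -> B} := [the {linear A -> B} of \0].

(* The standard free resolution  ... -> F_1 -> F_0 -> M -> 0  of M: F_n is the
   free module on the underlying set of the n-th syzygy, where the 0-th syzygy
   is M and the (n+1)-st is the kernel of F_n -> (n-th syzygy).
   Ext and Tor below are computed with this resolution of the first argument;
   up to isomorphism they do not depend on the resolution. *)

Section Resolution.
Variable R : comNzRingType.

Definition free_mod (M : lmodType R) : lmodType R := {freeg M / R}.

Definition free_cover (M : lmodType R) : {linear free_mod M -> M} :=
  [the {linear {freeg M / R} -> M} of free_lift (@id M)].

Fixpoint syzygy (M : lmodType R) (n : nat) : lmodType R :=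
  if n is n'.+1 then kernel (free_cover (syzygy M n')) else M.

Definition res (M : lmodType R) (n : nat) : lmodType R :=
  free_mod (syzygy M n).

Definition res_diff (M : lmodType R) (n : nat) :
    {linear res M n.+1 -> res M n} :=
  [the {linear _ -> _} of homology_incl (free_cover (syzygy M n))
     \o free_cover (syzygy M n.+1)].

Lemma res_diff_comp M n z : res_diff M n (res_diff M n.+1 z) = 0.
Proof.
exact: etrans (congr1 (homology_incl (free_cover (syzygy M n)))
  (homology_inclP (g := free_cover (syzygy M n.+1))
    (free_cover (syzygy M n.+2) z))) (linear0 _).
Qed.

(* H^n of  0 -> Hom(F_0, N) -> Hom(F_1, N) -> ... *)
Definition Ext (n : nat) (M N : lmodType R) : lmodType R :=
  if n is n'.+1 then
    homology (hom_precomp N (res_diff M n')) (hom_precomp N (res_diff M n'.+1))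
  else
    homology (zero_linear R^o (linHom (res M 0) N))
      (hom_precomp N (res_diff M 0)).

(* H_n of  ... -> F_1 (x) N -> F_0 (x) N -> 0 *)
Definition Tor (n : nat) (M N : lmodType R) : lmodType R :=
  if n is n'.+1 then
    homology (tensor_map N (res_diff M n'.+1)) (tensor_map N (res_diff M n'))
  else
    homology (tensor_map N (res_diff M 0)) (zero_linear (tensor (res M 0) N) R^o).

End Resolution.

Definition zero_module (R : comNzRingType) (M : lmodType R) : Prop :=
  forall m : M, m = 0.

Section Auslander.
Variable R : comNzRingType.

Definition finitely_generated (M : lmodType R) (S : {pred M}) : Prop :=
  exists (n : nat) (g : 'I_n -> M),
    forall m, m \in S <-> exists a : 'I_n -> R, m = \sum_i a i *: g i.

Definition noetherian : Prop :=
  forall I : submodClosed R^o, finitely_generated I.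

Definition finite_module (M : lmodType R) : Prop :=
  finitely_generated (predT : {pred M}).

(* r |-> (c |-> r *: c) *)
Definition homothety (C : lmodType R) (r : R^o) : linHom C C :=
  [the {linear C -> C} of *:%R (r : R)].

Fact homothety_is_linear C : linear (@homothety C).
Proof. by move=> a r s; apply: linHom_eq => c /=; rewrite scalerDl scalerA. Qed.

HB.instance Definition _ C :=
  GRing.isLinear.Build R R^o (linHom C C) *:%R (@homothety C)
    (@homothety_is_linear C).

Definition semidualizing (C : lmodType R) : Prop :=
  [/\ finite_module C,
      bijective (@homothety C) &
      forall i : nat, (0 < i)%N -> zero_module (Ext i C C)].

(* m |-> (c |-> c (x) m) *)
Definition tensor_unit (C M : lmodType R) (m : M) : linHom C (tensor C M) :=
  tensl C m.

Fact tensor_unit_is_linear C M : linear (@tensor_unit C M).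
Proof.
by move=> a m m'; apply: linHom_eq => c /=; rewrite tensDr tensZr.
Qed.

HB.instance Definition _ C M :=
  GRing.isLinear.Build R M (linHom C (tensor C M)) *:%R (@tensor_unit C M)
    (@tensor_unit_is_linear C M).

Definition auslander_class (C M : lmodType R) : Prop :=
  bijective (@tensor_unit C M) /\
  forall i : nat, (0 < i)%N ->
    zero_module (Tor i C M) /\ zero_module (Ext i C (tensor C M)).

Definition mult (M : lmodType R) (x : R) : {linear M -> M} :=
  [the {linear M -> M} of *:%R x].

Definition exact_at (A B D : lmodType R)
    (f : {linear A -> B}) (g : {linear B -> D}) : Prop :=
  range f = [set b | g b = 0].

Definition exact_zero_divisors (M : lmodType R) (x y : R) : Prop :=
  [/\ range (mult M x) <> [set 0],
      range (mult M x) <> setT,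
      exact_at (mult M x) (mult M y) &
      exact_at (mult M y) (mult M x)].

Definition quot_by (M : lmodType R) (x : R) : lmodType R :=
  quotmod (im_pred (mult M x)).

End Auslander.

(* Main.v *)
(** Exactness of the pair x, y passes from R to free modules and, by a diagram
    chase, to every syzygy of C; this makes F (x) R/xR exact in positive degrees
    for the free resolution F of C, which is the vanishing of Tor.

    Since y : C/xC -> C is injective with image the kernel of x, the module C/xC
    has the coresolution C -x-> C -y-> C -x-> ... .  As Ext^i(C, C) = 0 for
    i > 0, shifting along it reduces the rest to the complex
    Hom(C, C) -x-> Hom(C, C) -y-> Hom(C, C) -x-> ..., which is the exact
    complex R -x-> R -y-> R -x-> ... .  On cochains with values in C/xC, lifted
    to C, the shift is [cocycle_mod_lift]. *)

From HB Require Import structures.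
Require Import Defs.
From mathcomp Require Import all_boot all_algebra.
From mathcomp Require Import boolp classical_sets freeg.

Set Implicit Arguments.
Unset Strict Implicit.
Unset Printing Implicit Defensive.

Import GRing.Theory.
Local Open Scope ring_scope.

(** * Exact pairs of multiplications on free modules and on kernels *)

Section ExactMultiplication.
Variable R : comNzRingType.
Implicit Types (M F N : lmodType R) (x y : R).

(** Exactness alone holds on the zero module too, so it can pass to every syzygy. *)
Definition exact_mults M x y : Prop :=
  [/\ forall m : M, x *: (y *: m) = 0,
      forall m : M, x *: m = 0 -> exists n, m = y *: n &
      forall m : M, y *: m = 0 -> exists n, m = x *: n].

Lemma exact_mults_sym M x y : exact_mults M x y -> exact_mults M y x.
Proof. by case=> xy0 kx ky; split=> // m; rewrite scalerA mulrC -scalerA. Qed.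

Lemma exact_zero_divisors_mults M x y :
  exact_zero_divisors M x y -> exact_mults M x y.
Proof.
case=> _ _ xy yx; split=> m.
- have : [set b | mult M x b = 0]%classic (y *: m) by rewrite -yx; exists m.
  by [].
- move=> xm0; have : range (mult M y) m by rewrite yx.
  by case=> n _ <-; exists n.
- move=> ym0; have : range (mult M x) m by rewrite xy.
  by case=> n _ <-; exists n.
Qed.

Lemma exact_mults_free (K : choiceType) x y :
  exact_mults R^o x y -> exact_mults {freeg K / R} x y.
Proof.
have divides (a b : R) : (forall r : R^o, a *: r = 0 -> exists s, r = b *: s) ->
    forall D : {freeg K / R}, a *: D = 0 -> exists E, D = b *: E.
  move=> ab D aD0.
  have cD k : exists s : R, coeff k D = b * s.
    apply: ab; have := congr1 (coeff k) aD0.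
    by rewrite coeff_fgscale raddf0.
  (* Division is done coefficientwise; summing over the support of [D] keeps the quotient finite. *)
  have [s sP] := choice cD; exists (\sum_(k <- dom D) << s k *g k >>).
  rewrite scaler_sumr -[LHS]freeg_sumE; apply: eq_bigr => k _.
  apply/eqP/freeg_eqP => k'.
  by rewrite coeff_fgscale !coeffU sP mulrA.
case=> xy0 kx ky; split; [|exact: divides kx|exact: divides ky].
move=> D; apply/eqP/freeg_eqP => k; rewrite !coeff_fgscale coeff0.
exact: xy0.
Qed.

Lemma homology_incl_ker M N (f : {linear M -> N}) m :
  f m = 0 -> exists k, m = homology_incl f k.
Proof. by move=> /eqP fm0; exists (exist _ m fm0). Qed.

Lemma homology_incl_inj M N (f : {linear M -> N}) :
  injective (homology_incl f).
Proof. exact: val_inj. Qed.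

(** Exactness on [F] writes an element of the kernel killed by [a] as [b *: u]. Exactness on [M]
    gives [f u = a *: v]; subtracting [a] times a lift of [v] moves [u] into the kernel and leaves
    [b *: u] unchanged, since [b * a] kills [F]. *)
Lemma exact_mults_kernel F M (f : {linear F -> M}) x y :
    (forall m, exists u, m = f u) ->
  exact_mults F x y -> exact_mults M x y -> exact_mults (kernel f) x y.
Proof.
move=> f_surj Fxy Mxy.
have inclZ a k : homology_incl f (a *: k) = a *: homology_incl f k.
  exact: linearZ_LR.
have divides a b : exact_mults F a b -> exact_mults M a b ->
    forall k : kernel f, a *: k = 0 -> exists l, k = b *: l.
  case=> [ab0 ka _] [_ _ kb] k ak0.
  have [u ku] : exists u, homology_incl f k = b *: u.
    by apply: ka; rewrite -inclZ ak0 linear0.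
  have [v fu] : exists v, f u = a *: v.
    by apply: kb; rewrite -linearZ_LR -ku homology_inclP.
  have [w fw] := f_surj v.
  have [l lE] : exists l, u - a *: w = homology_incl f l.
    by apply: homology_incl_ker; rewrite linearB linearZ_LR fu fw subrr.
  exists l; apply: (@homology_incl_inj _ _ f).
  by rewrite inclZ -lE scalerBr -ku [b *: _]scalerA mulrC -scalerA ab0 subr0.
split; last 2 first.
- exact: divides.
- by apply: divides; exact: exact_mults_sym.
case: Fxy => xy0 _ _ k; apply: (@homology_incl_inj _ _ f).
by rewrite !inclZ xy0 linear0.
Qed.

End ExactMultiplication.

(** * Maps out of free modules *)

Section FreeModules.
Variables (R : comNzRingType) (K : choiceType) (N : lmodType R).

Lemma free_linear_ext (f g : {linear {freeg K / R} -> N}) :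
  (forall k, f << k >> = g << k >>) -> f =1 g.
Proof.
move=> fg D; rewrite -(freeg_sumE D) !linear_sum; apply: eq_bigr => k _.
suff -> : << coeff k D *g k >> = coeff k D *: << k >> :> {freeg K / R}.
  by rewrite !linearZ_LR /= fg.
by apply/eqP/freeg_eqP => k'; rewrite coeff_fgscale !coeffU mul1r.
Qed.

Definition free_linear (f : K -> N) : {linear {freeg K / R} -> N} :=
  [the {linear _ -> _} of free_lift f].

Lemma free_linearU (f : K -> N) k : free_linear f << k >> = f k.
Proof. exact: etrans (liftU f 1 k) (scale1r _). Qed.

End FreeModules.

(** Projectivity: chosen preimages of the values on the basis define the lift. *)
Lemma free_lifting (R : comNzRingType) (K : choiceType) (M N : lmodType R)
    (f : {linear {freeg K / R} -> N}) (g : {linear M -> N}) :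
  (forall k, exists m, f << k >> = g m) ->
  exists h : {linear {freeg K / R} -> M}, f =1 g \o h.
Proof.
move=> /choice[h hP]; exists (free_linear h).
apply: (@free_linear_ext _ _ _ f [the {linear _ -> _} of g \o free_linear h]).
by move=> k; rewrite hP /= free_linearU.
Qed.

Lemma free_divides (R : comNzRingType) (K : choiceType) (N : lmodType R) (a b : R)
    (f : {linear {freeg K / R} -> N}) :
    (forall n : N, a *: n = 0 -> exists n', n = b *: n') ->
    (forall u, a *: f u = 0) ->
  exists g : {linear {freeg K / R} -> N}, forall u, f u = b *: g u.
Proof.
by move=> ab af0; apply: (free_lifting (g := mult N b)) => k; exact: ab.
Qed.

(** * Quotients by [x] and tensor products with [R/xR] *)

Definition qmod (R : comNzRingType) (M : lmodType R) (x : R) :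
    {linear M -> quot_by M x} :=
  [the {linear _ -> _} of qclass (im_pred (mult M x))].

Lemma qmod_eq0 (R : comNzRingType) (M : lmodType R) (x : R) (m : M) :
  qmod M x m = 0 <-> exists n, m = x *: n.
Proof.
rewrite -[0](linear0 (qmod M x)); split => [/qclass_eq|[n ->]].
  by rewrite subr0 => /asboolP.
by apply/qclass_eq/asboolP; exists n; rewrite subr0.
Qed.

Lemma qmod_surj (R : comNzRingType) (M : lmodType R) (x : R) (q : quot_by M x) :
  exists m, q = qmod M x m.
Proof. exact: qclassP. Qed.

Section TensorQuotient.
Variables (R : comNzRingType) (x : R) (A : lmodType R).

Let Rx := quot_by R^o x.
Let rclass : {linear R^o -> Rx} := qmod R^o x.

(** Induces the isomorphism from [A/xA] to the tensor product, so tensors are handled below as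
    elements of [A] modulo [xA]. *)
Definition tens1 : {linear A -> tensor A Rx} := tensl A (rclass 1).

Lemma tens_rclass a r : tens a (rclass r) = tens1 (r *: a).
Proof.
rewrite -[r in LHS]mulr1 (linearZ_LR rclass r (1 : R^o)) tensZr.
by rewrite linearZ_LR.
Qed.

Lemma tens1_surj t : exists a, t = tens1 a.
Proof.
have [D ->] := qclassP t.
pose c := [the {linear {freeg (A * Rx)%type / R} -> tensor A Rx} of
  qclass (span_pred (@tensor_rel R A Rx))].
(* Each generator is [tens1] of some element, so the projection from the free module on pairs lifts
   through [tens1]. *)
have [h hP] : exists h : {linear {freeg (A * Rx)%type / R} -> A},
    c =1 tens1 \o h.
  apply: free_lifting => -[a q]; have [r ->] := qmod_surj q.
  by exists (r *: a); rewrite -tens_rclass.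
by exists (h D); exact: hP.
Qed.

(** The bilinear map behind the inverse isomorphism; changing the representative alters the value by
    a multiple of [x]. *)
Definition tensor_pairing (p : A * Rx) : quot_by A x :=
  qmod A x ((repr p.2 : R) *: p.1).

Lemma tensor_pairingE a r :
  tensor_pairing (a, rclass r) = qmod A x ((r : R) *: a).
Proof.
apply/eqP; rewrite -subr_eq0 -linearB /= -scalerBl; apply/eqP/qmod_eq0.
have /qmod_eq0[s sP] : rclass (repr (rclass r) - r) = 0.
  by rewrite linearB; apply/eqP; rewrite subr_eq0; apply/eqP; exact: reprK.
by exists (s *: a); rewrite sP scalerA.
Qed.

Lemma free_lift_tensor_pairing D :
  D \in span_pred (@tensor_rel R A Rx) -> free_lift tensor_pairing D = 0.
Proof.
pose L := free_linear tensor_pairing.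
move=> /asboolP/(_ (ker_pred L)) H; apply/eqP/H => {D H} D.
have E a r : L << (a, rclass r) >> = qmod A x ((r : R) *: a).
  exact: etrans (free_linearU _ _) (tensor_pairingE _ _).
case=> [a a' q|a q q'|s a q|s a q]; have [r ->] := qmod_surj q;
  rewrite -[_ \in _]/(L _ == 0) (linearB L) subr_eq0
    ?(linearD L) ?(linearZ_LR L).
- by rewrite !E scalerDr linearD.
- have [r' ->] := qmod_surj q'.
  by rewrite -(linearD rclass) !E scalerDl linearD.
- by rewrite !E scalerA mulrC -scalerA linearZ_LR.
- by rewrite -(linearZ_LR rclass) !E -scalerA linearZ_LR.
Qed.

Lemma tens1_eq0 a : tens1 a = 0 <-> exists b, a = x *: b.
Proof.
split=> [ta0|[b ->]]; last first.
  rewrite -tens_rclass; have -> : rclass x = 0.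
    by apply/qmod_eq0; exists 1; rewrite /GRing.scale /= mulr1.
  exact: (linear0 (tensr _ b)).
have qta0 := congr1 (qlift_linear free_lift_tensor_pairing) ta0.
rewrite linear0 in qta0; apply/qmod_eq0; rewrite -[RHS]qta0; apply: esym.
apply: etrans (qliftE free_lift_tensor_pairing _) _.
by rewrite [LHS]free_linearU tensor_pairingE scale1r.
Qed.

End TensorQuotient.

(** * Factoring through surjections; vanishing of homology, [Ext] and [Tor] *)

Lemma factor_surjection (R : comNzRingType) (F M N : lmodType R)
    (f : {linear F -> M}) (g : {linear F -> N}) :
    (forall m, exists u, m = f u) -> (forall u, f u = 0 -> g u = 0) ->
  exists h : {linear M -> N}, g =1 h \o f.
Proof.
(* The section [s] need not be linear, but [h] is, because [g] kills the kernel of [f]. *)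
move=> /choice[s sP] fg; pose h m := g (s m).
have gE u v : f u = f v -> g u = g v.
  move=> fuv; apply/eqP; rewrite -subr_eq0 -linearB fg //.
  by rewrite linearB fuv subrr.
have h_linear : linear h.
  by move=> a m m'; rewrite /h -linearP; apply: gE; rewrite linearP -!sP.
pose H : {linear M -> N} := HB.pack h (GRing.isLinear.Build _ _ _ _ _ h_linear).
by exists H => u; apply: gE; exact: sP.
Qed.

Lemma zero_homologyP (R : comNzRingType) (A B D : lmodType R)
    (f : {linear A -> B}) (g : {linear B -> D}) :
  zero_module (homology f g) <-> forall b, g b = 0 -> exists a, b = f a.
Proof.
pose q := qclass (@boundary_pred _ _ _ _ f g).
have q0 : q 0 = 0 by exact: linear0.
split=> [H0 b /homology_incl_ker[k ->]|fg m].
  have : q k = q 0 by rewrite q0; exact: H0.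
  by move=> /qclass_eq; rewrite subr0 => /asboolP.
have [k ->] := qclassP m; rewrite -[RHS]q0; apply/qclass_eq; rewrite subr0.
by apply/asboolP/fg/homology_inclP.
Qed.

Section StandardResolution.
Variables (R : comNzRingType) (M : lmodType R).

Lemma free_cover_surj (N : lmodType R) n : exists u, n = free_cover N u.
Proof. by exists << n >>; rewrite [RHS]free_linearU. Qed.

Lemma res_diffE n u :
  res_diff M n u = homology_incl (free_cover (syzygy M n))
                     (free_cover (syzygy M n.+1) u).
Proof. by []. Qed.

Lemma free_cover_res_diff n u : free_cover (syzygy M n) (res_diff M n u) = 0.
Proof. exact: homology_inclP. Qed.

Lemma free_cover_ker n u :
  free_cover (syzygy M n) u = 0 -> exists v, u = res_diff M n v.
Proof.
move=> /homology_incl_ker[k ->].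
by have [v ->] := free_cover_surj k; exists v.
Qed.

Lemma res_diff_ker n u :
  res_diff M n u = 0 -> exists v, u = res_diff M n.+1 v.
Proof.
move=> du0; apply: free_cover_ker.
apply: (@homology_incl_inj _ _ _ (free_cover (syzygy M n))).
by rewrite linear0; exact: du0.
Qed.

Lemma exact_mults_syzygy x y n :
  exact_mults R^o x y -> exact_mults M x y -> exact_mults (syzygy M n) x y.
Proof.
move=> Rxy Mxy; elim: n => //= n IHn.
apply: exact_mults_kernel IHn; first exact: free_cover_surj.
exact: exact_mults_free.
Qed.

Lemma zero_ExtP (N : lmodType R) n :
  zero_module (Ext n.+1 M N) <->
  forall f : {linear res M n.+1 -> N}, (forall u, f (res_diff M n.+1 u) = 0) ->
    exists g : {linear res M n -> N}, forall u, f u = g (res_diff M n u).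
Proof.
split=> [/zero_homologyP E f fd0|E].
  have [|g fE] := E f; first exact: linHom_eq.
  by exists g => u; rewrite fE.
apply/zero_homologyP => f fd0; have [|g fE] := E f.
  by move=> u; have := congr1 (fun h : linHom _ _ => h u) fd0.
by exists g; apply: linHom_eq.
Qed.

(** If [u] is a cycle modulo [x], then [y] kills its image in the syzygy, which is therefore
    [x *: k]. For a lift [v] of [k], [u - x *: v] is a boundary, and [x *: v] dies in the tensor
    product. *)
Lemma zero_Tor_quot_by x y n :
  exact_mults R^o x y -> exact_mults M x y ->
  zero_module (Tor n.+1 M (quot_by R^o x)).
Proof.
move=> Rxy Mxy; apply/zero_homologyP => t; have [u ->] := tens1_surj t.
rewrite /tens1 [X in X = 0]tensor_mapE => /tens1_eq0[f duE].
have [xy0 _ Fy] := exact_mults_free (syzygy M n) Rxy.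
have [_ _ Ky] := exact_mults_syzygy n.+1 Rxy Mxy.
have [k uE] : exists k, free_cover (syzygy M n.+1) u = x *: k.
  apply: Ky; apply: (@homology_incl_inj _ _ _ (free_cover (syzygy M n))).
  rewrite linearZ_LR -res_diffE duE linear0 scalerA mulrC -scalerA.
  exact: xy0.
have [v kE] := free_cover_surj k.
have [w wE] : exists w, u - x *: v = res_diff M n.+1 w.
  apply: free_cover_ker.
  by rewrite linearB uE kE linearZ_LR subrr.
exists (tens1 x _ w); rewrite /tens1 [RHS]tensor_mapE -wE.
rewrite -[LHS]/(tens1 x _ u) -[RHS]/(tens1 x _ (u - x *: v)) linearB.
suff -> : tens1 x _ (x *: v) = 0 by rewrite subr0.
by apply/tens1_eq0; exists v.
Qed.

End StandardResolution.

(** * The unit map and [Ext] for a module whose endomorphisms are homotheties *)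

Section Homothety.
Variables (R : comNzRingType) (C : lmodType R).
Hypothesis C_homothety : bijective (@homothety R C).

Lemma endo_homothety (f : {linear C -> C}) : exists a, forall c, f c = a *: c.
Proof.
by case: C_homothety => g _ gK; exists (g f) => c; rewrite -[in LHS](gK f).
Qed.

Lemma homothety_faithful a : (forall c : C, a *: c = 0) -> a = 0.
Proof.
move=> a0; apply: (bij_inj C_homothety); apply: linHom_eq => c.
by rewrite /= a0 scale0r.
Qed.

Lemma annihilator_divides x y a :
    (forall r : R^o, x *: r = 0 -> exists s, r = y *: s) ->
  (forall c : C, x *: (a *: c) = 0) -> exists b, a = y * b.
Proof.
move=> xy xa0; apply: xy; apply: (homothety_faithful (a := x * a)) => c.
by rewrite -scalerA xa0.
Qed.

Lemma tensor_unit_quot_by_bij x y :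
  exact_mults R^o x y -> exact_mults C x y ->
  bijective (@tensor_unit R C (quot_by R^o x)).
Proof.
move=> [_ Rx Ry] [xy0 _ Cy].
pose T := [the {linear quot_by R^o x -> linHom C _} of
  @tensor_unit R C (quot_by R^o x)].
have TE r c : T (qmod R^o x r) c = tens1 x C (r *: c) by exact: tens_rclass.
have T_inj : injective T.
  move=> p q Tpq; apply/eqP; rewrite -subr_eq0; apply/eqP.
  have : T (p - q) = 0 by rewrite linearB Tpq subrr.
  have [r ->] := qmod_surj (p - q) => Tr0.
  (* Here [r] maps [C] into [xC], so [y * r] kills [C]. *)
  apply/qmod_eq0; apply: annihilator_divides Ry _ => c.
  have /tens1_eq0[b rcE] : tens1 x C (r *: c) = 0 by rewrite -TE Tr0.
  by rewrite rcE scalerA mulrC -scalerA xy0.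
have T_surj f : exists q, T q = f.
  (* [Y] is the injection from [C/xC] to [C] induced by [y]; composed with [f] it is a homothety
     [a]. As [x] kills its image, [a = y * b], and [b] gives the preimage of [f]. *)
  have [|Y YE] := factor_surjection (g := mult C y) (@tens1_surj R x C).
    by move=> c /tens1_eq0[b ->]; rewrite /= scalerA mulrC -scalerA xy0.
  have [a aE] := endo_homothety [the {linear C -> C} of Y \o f].
  have yE c s : f c = tens1 x C s -> y *: s = a *: c.
    by rewrite -aE /= => ->; exact: YE.
  have [b abE] : exists b : R, a = y * b.
    apply: annihilator_divides Rx _ => c.
    by have [s /yE <-] := tens1_surj (f c); rewrite xy0.
  exists (qmod R^o x b); apply: linHom_eq => c; rewrite TE.
  have [s fcE] := tens1_surj (f c); rewrite fcE; apply: esym; apply/eqP.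
  rewrite -subr_eq0 -linearB; apply/eqP/tens1_eq0/Cy.
  by rewrite scalerBr (yE c) // abE scalerA subrr.
have [g gP] := choice T_surj.
by exists g => // q; apply: T_inj.
Qed.

Hypothesis C_rigid : forall n, zero_module (Ext n.+1 C C).

(* The hypothesis on [f] says that [f] is a cocycle modulo [x *: C]; then
   [y *: f] is a genuine cocycle, hence a coboundary [g0 \o res_diff C n], and
   [g0] is in turn a cocycle modulo [y *: C]. *)
Lemma cocycle_mod_lift n x y (f : {linear res C n.+1 -> C}) :
    exact_mults R^o x y -> exact_mults C x y ->
    (forall u, y *: f (res_diff C n.+1 u) = 0) ->
  exists (g : {linear res C n -> C}) (h : {linear res C n.+1 -> C}),
    forall u, f u = g (res_diff C n u) + x *: h u.
Proof.
elim: n x y f => [|n IHn] x y f Rxy Cxy yfd0.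
all: have [_ _ Ry] := Rxy; have [xy0 Cx Cy] := Cxy.
all: have [g0 g0E] := (zero_ExtP C C _).1 (@C_rigid _)
    [the {linear _ -> C} of y \*: f] yfd0.
all: have xg0d u : x *: g0 (res_diff C _ u) = 0 by rewrite -g0E /= xy0.
(* Degree zero: [x \*: g0] vanishes on boundaries, so it descends to an endomorphism of [C], a
   homothety [a] with [y * a = 0]. *)
- have [|h hE] := factor_surjection (g := [the {linear _ -> C} of x \*: g0])
    (@free_cover_surj R C).
    by move=> u /(@free_cover_ker R C 0)[v ->]; exact: xg0d.
  have [a aE] := endo_homothety h.
  have [b abE] : exists b : R, a = x * b.
    apply: annihilator_divides Ry _ => c; have [u ->] := free_cover_surj c.
    by rewrite -aE -[h _]hE /= scalerA mulrC -scalerA xy0.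
  (* Subtracting [b] times the augmentation makes [g0] killed by [x] without changing its
     coboundary. *)
  pose g1 := [the {linear res C 0 -> C} of g0 \- b \*: free_cover C].
  have [u|g gE] := free_divides Cx (f := g1).
    by rewrite /= scalerBr scalerA -abE -aE -[h _]hE subrr.
  have [u|k kE] := free_divides Cy
      (f := [the {linear _ -> C} of f \- (g \o res_diff C 0)]).
    rewrite /= scalerBr -gE /= (@free_cover_res_diff R C 0 u) scaler0 subr0.
    by rewrite -g0E subrr.
  by exists g, k => u; rewrite -kE /= addrC subrK.
(* Induction with [x] and [y] exchanged: modulo a coboundary [g0] is [y \*: h], so [y] kills [f]
   minus the coboundary of [h]. *)
- have [g [h ghE]] := IHn y x g0
    (exact_mults_sym Rxy) (exact_mults_sym Cxy) xg0d.
  have [u|k kE] := free_divides Cy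
      (f := [the {linear _ -> C} of f \- (h \o res_diff C n.+1)]).
    have := g0E u; rewrite ghE res_diff_comp linear0 add0r /= => yfE.
    by rewrite scalerBr yfE subrr.
  by exists h, k => u; rewrite -kE /= addrC subrK.
Qed.

(** A cocycle lifts through [tens1] to a cochain in [C] that is a cocycle modulo [xC]; the term
    [x *: h u] of its decomposition vanishes under [tens1]. *)
Lemma zero_Ext_quot_by x y n :
  exact_mults R^o x y -> exact_mults C x y ->
  zero_module (Ext n.+1 C (tensor C (quot_by R^o x))).
Proof.
move=> Rxy Cxy; apply/zero_ExtP => f fd0.
have [i|F fE] := free_lifting (f := f) (g := tens1 x C).
  exact: tens1_surj.
have [|g [h FE]] := cocycle_mod_lift (f := F) Rxy Cxy.
  move=> u; have := fd0 u; rewrite fE => /tens1_eq0[c /= ->].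
  by have [xy0 _ _] := Cxy; rewrite scalerA mulrC -scalerA xy0.
exists [the {linear _ -> _} of tens1 x C \o g] => u.
rewrite fE -[LHS]/(tens1 x C (F u)) FE linearD -[RHS]addr0; congr (_ + _).
by apply/tens1_eq0; exists (h u).
Qed.

End Homothety.

Theorem proposition4p1 (R : comNzRingType) (C : lmodType R) (x y : R)
    (R_noetherian : noetherian R)
    (C_semidualizing : semidualizing C)
    (R_exact : exact_zero_divisors R^o x y)
    (C_exact : exact_zero_divisors C x y) :
  auslander_class C (quot_by R^o x).
Proof.
have [_ C_homothety C_rigid] := C_semidualizing.
have Rxy := exact_zero_divisors_mults R_exact.
have Cxy := exact_zero_divisors_mults C_exact.
split; first exact: tensor_unit_quot_by_bij Rxy Cxy.
case=> // n _; split; first exact: zero_Tor_quot_by Rxy Cxy.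
by apply: zero_Ext_quot_by Rxy Cxy => // m; exact: C_rigid.
Qed.
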